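(* Let $\delta^{(2)}_n=1$ if $n$ is a power of $2$ (including $n=1$) and $\delta^{(2)}_n=0$ otherwise. Define $c_n=\mu(n)$ for odd $n$ and $c_n=2^{\nu_2(n)-1}\mu\left(n/2^{\nu_2(n)}\right)$ for even $n$. Then for every $n\ge1$, \[ \delta_{n}^{(2)}=\sum_{d\mid n}c_{n/d}\,\Delta s_{2}(d-1). \]
   Context: $s_2(n)$ is the number of ones in the binary expansion of $n$ and $\Delta s_2(m)=s_2(m+1)-s_2(m)$. $\nu_2(n)$ is the exponent of the highest power of $2$ dividing $n$, and $\mu$ is the Möbius function. *)

(* Defs.v *)
From mathcomp Require Import all_boot all_order all_algebra.

Set Implicit Arguments.
Unset Strict Implicit.
Unset Printing Implicit Defensive.

Import Order.TTheory GRing.Theory Num.Theory.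

Local Open Scope ring_scope.

(* [odd (n %/ 2 ^ i)] is the i-th binary digit of n; the digits with i >= n
   vanish because n < 2 ^ n. *)
Definition s2 (n : nat) : nat := (\sum_(i < n) odd (n %/ 2 ^ i))%N.

Definition Delta_s2 (m : nat) : int := (s2 m.+1)%:Z - (s2 m)%:Z.

(* Only meaningful for 0 < n. *)
Definition mobius (n : nat) : int :=
  if all (fun p => ~~ (p ^ 2 %| n)%N) (primes n)
  then (-1) ^+ size (primes n) else 0.

(* The bound on the exponent loses nothing, since k < 2 ^ k. *)
Definition delta2 (n : nat) : int :=
  if [exists k : 'I_n, n == (2 ^ k)%N] then 1 else 0.

(* For even n > 0 one has 1 <= logn 2 n, so the truncated predecessor is the
   true one. *)
Definition c (n : nat) : int :=
  if odd n then mobius n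
  else 2 ^+ (logn 2 n).-1 * mobius (n %/ 2 ^ logn 2 n)%N.

(* Main.v *)
(** Since [s2 d - s2 (d - 1) = 1 - nu_2 d], writing [n = 2 ^ a * m] with [m] odd
    factors the sum as
    [(\sum_(i <= a) w i * (1 - (a - i))) * \sum_(e | m) mobius (m / e)], where
    [w 0 = 1] and [w i.+1 = 2 ^ i].  The first factor is always [1], by induction
    on [a]; the second is the indicator of [m = 1]. *)

Require Import Defs.
From mathcomp Require Import all_boot all_order all_algebra.
From mathcomp Require Import zify.

Import Order.TTheory GRing.Theory Num.Theory.
Local Open Scope ring_scope.

(** Freedom in the range lets the digit sums of [n] and [n./2] be taken over lengths that differ by
    exactly one, so that they match after a shift. *)
Lemma s2_widen (n N : nat) : (n <= N)%N ->
  s2 n = (\sum_(i < N) odd (n %/ 2 ^ i))%N.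
Proof.
move=> leN; rewrite -(subnKC leN) big_split_ord /= [X in (_ + X)%N]big1 ?addn0 //.
move=> i _; rewrite divn_small //.
by apply: leq_trans (ltn_expl n (ltnSn 1)) _; rewrite leq_exp2l ?leq_addr.
Qed.

Lemma s2_half (n : nat) : s2 n = (odd n + s2 n./2)%N.
Proof.
rewrite (@s2_widen n n.+1) // big_ord_recl /= expn0 divn1.
rewrite (@s2_widen n./2 n) ?half_leq //; last by lia.
by congr (_ + _)%N; apply: eq_bigr => i _; rewrite expnS divnMA divn2.
Qed.

(** Strong induction along the carry: for even [n] only the last digit changes and [n.+1] is odd;
    for odd [n] the last digit becomes 0 and the carry passes to [n./2], while the valuation gains
    one. *)
Lemma s2_succ (n : nat) : (s2 n.+1 + logn 2 n.+1 = (s2 n).+1)%N.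
Proof.
elim/ltn_ind: n => n IHn; rewrite (s2_half n.+1) (s2_half n) /=.
have [oddn|evenn] := boolP (odd n); last first.
  by rewrite lognE dvdn2 /= evenn uphalf_half (negbTE evenn) addn0.
have lt_half : (n./2 < n)%N by lia.
have -> : logn 2 n.+1 = (logn 2 n./2.+1).+1.
  by rewrite (_ : n.+1 = 2 * n./2.+1)%N ?lognM //; lia.
by rewrite uphalf_half oddn addnS IHn.
Qed.

Lemma Delta_s2_pred (d : nat) : (0 < d)%N ->
  Delta_s2 d.-1 = 1 - (logn 2 d)%:Z.
Proof. by case: d => // d _; have := s2_succ d; rewrite /Delta_s2 /=; lia. Qed.

(** The exponent is written [a - i] so that [i] is the exponent of [p] in the complementary
    divisor. *)
Lemma perm_divisors_pfactor (p a m : nat) :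
    prime p -> (0 < m)%N -> ~~ (p %| m)%N ->
  perm_eq (divisors (p ^ a * m)%N)
    [seq (p ^ (a - i) * e)%N | i <- iota 0 a.+1, e <- divisors m].
Proof.
move=> pr_p m_gt0 pNm; have p_gt0 := prime_gt0 pr_p.
(* The valuation at [p] recovers the exponent, so no divisor is listed twice. *)
have logE i e : e \in divisors m -> logn p (p ^ i * e) = i.
  rewrite -dvdn_divisors // => em.
  have pNe : ~~ (p %| e)%N by apply: contra pNm => /dvdn_trans; apply.
  rewrite lognM ?expn_gt0 ?p_gt0 ?(dvdn_gt0 m_gt0) // pfactorK //.
  by rewrite lognE (negbTE pNe) !andbF addn0.
have pam_gt0 : (0 < p ^ a * m)%N by rewrite muln_gt0 expn_gt0 p_gt0.
apply: uniq_perm; first exact: divisors_uniq.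
  apply: allpairs_uniq; [exact: iota_uniq | exact: divisors_uniq |].
  move=> x y /allpairsP[[i e] [ia em ->]] /allpairsP[[j f] [ja fm ->]] /= eq_ie.
  have := congr1 (logn p) eq_ie; rewrite !logE // => eq_ij.
  move: ia ja; rewrite !mem_iota /= => ia ja.
  have eij : i = j by lia.
  by move/eqP: eq_ie; rewrite eij eqn_pmul2l ?expn_gt0 ?p_gt0 // => /eqP ->.
move=> d; rewrite -dvdn_divisors //; apply/idP/allpairsP => [dvd_d|].
  have d_gt0 := dvdn_gt0 pam_gt0 dvd_d.
  have [k pNk d_eq] := pfactor_coprime pr_p d_gt0.
  have le_a : (logn p d <= a)%N.
    have := dvdn_leq_log p pam_gt0 dvd_d; rewrite lognM ?expn_gt0 ?p_gt0 //.
    by rewrite pfactorK // [logn p m]lognE (negbTE pNm) !andbF addn0.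
  (* The part of [d] prime to [p] divides [p ^ a * m], hence [m], by Gauss. *)
  have km : (k %| m)%N.
    rewrite -(@Gauss_dvdr k (p ^ a)) ?coprimeXr 1?coprime_sym //.
    by apply: dvdn_trans dvd_d; rewrite d_eq dvdn_mulr.
  exists ((a - logn p d)%N, k); split; last by rewrite /= subKn // mulnC -d_eq.
    by rewrite mem_iota ltnS leq_subr.
  by rewrite -dvdn_divisors.
case=> -[i e] /= [_ em ->]; apply: dvdn_mul; first by rewrite dvdn_exp2l ?leq_subr.
by rewrite dvdn_divisors.
Qed.

(** [F] sees both members of a complementary pair, so this serves the Möbius sum as well as the
    final convolution. *)
Lemma sum_divisors_pfactor (V : nmodType) (F : nat -> nat -> V) (p a m : nat) :
    prime p -> (0 < m)%N -> ~~ (p %| m)%N ->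
  \sum_(d <- divisors (p ^ a * m)%N) F (p ^ a * m %/ d)%N d =
  \sum_(i < a.+1) \sum_(e <- divisors m) F (p ^ i * (m %/ e))%N (p ^ (a - i) * e)%N.
Proof.
move=> pr_p m_gt0 pNm; have p_gt0 := prime_gt0 pr_p.
rewrite (perm_big _ (perm_divisors_pfactor p a m pr_p m_gt0 pNm)).
rewrite big_allpairs_dep -[iota 0 a.+1]/(index_iota 0 a.+1) big_mkord.
apply: eq_bigr => i _; apply: eq_big_seq => e; rewrite -dvdn_divisors // => em.
have e_gt0 := dvdn_gt0 m_gt0 em.
congr (F _ _); have ia : (i <= a)%N by rewrite -ltnS.
apply/eqP; rewrite eq_sym eqn_div ?muln_gt0 ?expn_gt0 ?p_gt0 //; last first.
  by rewrite dvdn_mul ?dvdn_exp2l ?leq_subr.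
by rewrite mulnACA -expnD subnKC // divnK // eqxx.
Qed.

Lemma mobius_sqfactor (p m : nat) : prime p -> (0 < m)%N -> (p ^ 2 %| m)%N ->
  mobius m = 0.
Proof.
move=> pr_p m_gt0 p2m; rewrite /mobius; case: ifP => // /allP/(_ p).
rewrite mem_primes pr_p m_gt0 (dvdn_trans _ p2m) ?dvdn_exp //.
by move/(_ isT); rewrite p2m.
Qed.

Lemma mobius_prime_mul (p m : nat) : prime p -> (0 < m)%N -> ~~ (p %| m)%N ->
  mobius (p * m)%N = - mobius m.
Proof.
move=> pr_p m_gt0 pNm; have p_gt0 := prime_gt0 pr_p.
have perm_pm : perm_eq (primes (p * m)) (p :: primes m).
  apply: uniq_perm; rewrite /= ?primes_uniq //.
    by rewrite mem_primes (negbTE pNm) !andbF.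
  by move=> q; rewrite primesM // primes_prime // !inE.
rewrite /mobius (perm_all _ perm_pm) (perm_size perm_pm) /= dvdn_pmul2l // pNm /=.
(* A prime [q] dividing [m] differs from [p], so [q ^ 2] is coprime to [p]. *)
have -> : all (fun q => ~~ (q ^ 2 %| p * m)%N) (primes m) =
          all (fun q => ~~ (q ^ 2 %| m)%N) (primes m).
  apply: eq_in_all => q; rewrite mem_primes => /and3P[pr_q _ qm].
  rewrite Gauss_dvdr // coprimeXl // prime_coprime // dvdn_prime2 //.
  by apply: contra pNm => /eqP <-.
by case: ifP; rewrite ?oppr0 // exprS mulN1r.
Qed.

Lemma sum_mobius (n : nat) : (0 < n)%N ->
  \sum_(d <- divisors n) mobius (n %/ d)%N = (n == 1%N)%:R.
Proof.
move=> n_gt0; have [->|n_neq1] := eqVneq n 1%N.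
  by rewrite (_ : divisors 1 = [:: 1%N]) // big_seq1.
have n_gt1 : (1 < n)%N by lia.
have pr_p := pdiv_prime n_gt1; set p := pdiv n in pr_p.
have [m copm n_eq] := pfactor_coprime pr_p n_gt0.
have m_gt0 : (0 < m)%N by move: n_gt0; rewrite n_eq muln_gt0 => /andP[].
have pNm : ~~ (p %| m)%N by rewrite -prime_coprime.
have : (0 < logn p n)%N by rewrite logn_gt0 mem_primes pr_p n_gt0 pdiv_dvd.
case: (logn p n) n_eq => // a -> _.
rewrite mulnC (@sum_divisors_pfactor _ (fun k _ => mobius k)) //.
(* With [p ^ a.+1] split off, the terms where [p] has exponent at least 2 vanish; those with
   exponents 0 and 1 cancel in pairs. *)
rewrite !big_ord_recl /= [X in _ + (_ + X)]big1 ?addr0 => [|i _]; last first.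
  rewrite big_seq big1 // => e; rewrite -dvdn_divisors // => em.
  apply: (@mobius_sqfactor p) => //.
    by rewrite muln_gt0 expn_gt0 prime_gt0 //= divn_gt0 ?(dvdn_gt0 m_gt0) // dvdn_leq.
  by rewrite dvdn_mulr // dvdn_exp2l.
rewrite -big_split big_seq big1 //= => e; rewrite -dvdn_divisors // => em.
rewrite mul1n expn1 mobius_prime_mul ?subrr //.
  by rewrite divn_gt0 ?(dvdn_gt0 m_gt0) // dvdn_leq.
by apply: contra pNm => /dvdn_trans; apply; rewrite dvdn_div.
Qed.

Lemma c_pow2_mul (i m : nat) : odd m ->
  c (2 ^ i * m)%N = (if i is k.+1 then 2 ^+ k else 1) * mobius m.
Proof.
move=> odd_m; have m_gt0 := odd_gt0 odd_m.
have log_m : logn 2 m = 0%N by rewrite lognE dvdn2 odd_m andbF.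
case: i => [|i]; first by rewrite mul1n mul1r /c odd_m.
rewrite /c oddM oddX /= lognM ?expn_gt0 // pfactorK // log_m addn0 /=.
by rewrite mulKn ?expn_gt0.
Qed.

Lemma sum_weights (a : nat) :
  \sum_(i < a.+1) (if val i is k.+1 then 2 ^+ k else 1) * (1 - (a - i)%:Z) = 1%R :> int.
Proof.
elim: a => [|a IHa]; first by rewrite big_ord1.
(* Let [S] be the sum for [a] without its term [i = 0]. The hypothesis reads [(1 - a) + S = 1], and
   the sum for [a.+1] is [- a + (1 - a) + 2 * S]. *)
rewrite !big_ord_recl /= in IHa *; rewrite !subn0 in IHa *.
under eq_bigr => i _ do rewrite /bump /= !add1n subSS exprS -mulrA.
move: IHa; under eq_bigr => i _ do rewrite /bump /= add1n add0n.
by rewrite -mulr_sumr subSS subn0 addn0 expr0; move: (bigop _ _ _) => S; lia.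
Qed.

Lemma delta2_pow2_mul (a m : nat) : odd m -> delta2 (2 ^ a * m)%N = (m == 1%N)%:R.
Proof.
move=> odd_m; rewrite /delta2; have [->|m_neq1] := eqVneq m 1%N.
  rewrite muln1; case: existsP => // -[].
  by exists (Ordinal (ltn_expl a (ltnSn 1))) => /=.
case: existsP => // -[k /eqP eq_k]; case/eqP: m_neq1.
(* A divisor of a power of 2 is a power of 2, and oddness leaves only exponent 0. *)
have /(dvdn_pfactor _ _ (isT : prime 2))[[|j] _ mE] : (m %| 2 ^ k)%N by rewrite -eq_k dvdn_mull.
  exact: mE.
by move: odd_m; rewrite mE oddX.
Qed.

Theorem theorem15 (n : nat) (hn : (1 <= n)%N) :
  delta2 n = \sum_(d <- divisors n) c (n %/ d)%N * Delta_s2 d.-1.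
Proof.
have [m com ->] := pfactor_coprime (isT : prime 2) hn.
rewrite mulnC; move: (logn 2 n) => a.
have odd_m : odd m by rewrite -coprime2n.
have m_gt0 := odd_gt0 odd_m.
rewrite delta2_pow2_mul // (@sum_divisors_pfactor _ (fun k d => c k * Delta_s2 d.-1)) //;
  last by rewrite dvdn2 odd_m.
(* The indicator of [m = 1] is expanded into the Möbius sum and its factor 1 into the weight sum;
   the two double sums then agree term by term. *)
rewrite -sum_mobius // -[LHS]mul1r -(sum_weights a) mulr_suml.
apply: eq_bigr => i _; rewrite mulr_sumr; apply: eq_big_seq => e.
rewrite -dvdn_divisors // => em.
have odd_e : odd e := dvdn_odd em odd_m.
have e_gt0 := odd_gt0 odd_e.
rewrite c_pow2_mul ?(dvdn_odd (dvdn_div em)) // Delta_s2_pred; last first.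
  by rewrite muln_gt0 expn_gt0.
by rewrite lognM ?expn_gt0 // pfactorK // [logn 2 e]lognE dvdn2 odd_e andbF addn0 mulrAC.
Qed.
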